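(* For every $\varepsilon\in(0,1/2)$, \[ \lim_{K\to\infty}\mathbb{E}\left[\frac{1}{K}\left|\mathrm{BoA}_K\left(\eta_{\lfloor\varepsilon K\rfloor}\right)\right|\right]=\exp\left\{\sqrt{1-2\varepsilon}\right\}. \]
   Context: For an integer $K\ge 2$ let $[K]=\{1,\dots,K\}$. A (strict ordinal) potential on $[K]\times[K]$ is a bijection $\Psi:[K]\times[K]\to[K^2]$; it represents a two-player game in which player A chooses the first coordinate (row) $a$, player B chooses the second coordinate (column) $b$, and lower potential is better for both players (given the other player's action). The random potential $\Psi$ is chosen uniformly at random among all $(K^2)!$ such bijections. A pure Nash equilibrium (PNE) is a profile $(a^*,b^* )$ such that $\Psi(a^*,b^* )\le\Psi(a,b^* )$ for all $a$ and $\Psi(a^*,b^* )\le\Psi(a^*,b)$ for all $b$. Let $W_K$ be the number of PNE and order them by increasing potential as $\eta_1,\dots,\eta_{W_K}$ ($\eta_1$ has the smallest potential). Best-response dynamics (BRD) from a starting profile $(a_0,b_0)$: $\mathrm{BRD}(0)=(a_0,b_0)$; if $\mathrm{BRD}(t)=(a',b')$ and $t$ is even, then $\mathrm{BRD}(t+1)=(a'',b')$ where $a''$ is the element of $\arg\min_{a\in[K]}\Psi(a,b')\setminus\{a'\}$ if this set is nonempty, and $\mathrm{BRD}(t+1)=\mathrm{BRD}(t)$ otherwise; if $t$ is odd, then $\mathrm{BRD}(t+1)=(a',b'')$ where $b''$ is the element of $\arg\min_{b\in[K]}\Psi(a',b)\setminus\{b'\}$ if nonempty, and $\mathrm{BRD}(t+1)=\mathrm{BRD}(t)$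 otherwise. The dynamics is absorbed at a PNE within $2K$ steps, and $\mathrm{BRD}(2K)$ denotes that PNE. The basin of attraction of a PNE $\eta$ is $\mathrm{BoA}_K(\eta)=\{(a,b)\in[K]^2:\ \text{if }\mathrm{BRD}(0)=(a,b)\text{ then }\mathrm{BRD}(2K)=\eta\}$. Convention: if $j>W_K$ (no $j$-th equilibrium exists), $|\mathrm{BoA}_K(\eta_j)|$ is taken to be $0$. *)

(* Defs.v *)
From HB Require Import structures.
From mathcomp Require Import all_boot all_order all_algebra.
From mathcomp Require Import all_classical all_reals all_analysis.
Set Implicit Arguments. Unset Strict Implicit. Unset Printing Implicit Defensive.
Import Order.TTheory GRing.Theory Num.Theory.

(* A potential on [K]x[K]: a function to [K^2] (here 'I_(K*K), values
   0..K^2-1 instead of 1..K^2, which only shifts all potentials by one);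
   it is a bijection iff it is injective (equal cardinalities). *)
Definition potential (K : nat) := {ffun 'I_K * 'I_K -> 'I_(K * K)}.

Definition bijective_potentials (K : nat) : {set potential K} :=
  [set f : potential K | injectiveb f].

Section Game.
Variable K : nat.
Variable Psi : potential K.

Definition pot (p : 'I_K * 'I_K) : nat := Psi p.

Definition isPNE (p : 'I_K * 'I_K) : bool :=
  [forall a : 'I_K, pot p <= pot (a, p.2)] &&
  [forall b : 'I_K, pot p <= pot (p.1, b)].

Definition is_jth_PNE (j : nat) (p : 'I_K * 'I_K) : bool :=
  isPNE p && (0 < j) &&
  (#|[set q | isPNE q & pot q < pot p]|.+1 == j).

(* best-response moves: since Psi is injective the argmin is unique, and
   the move replaces the current action by it (no move if it already is
   the argmin) *)
Definition stepA (p : 'I_K * 'I_K) : 'I_K * 'I_K :=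
  ([arg min_(a < p.1) pot (a, p.2)], p.2).
Definition stepB (p : 'I_K * 'I_K) : 'I_K * 'I_K :=
  (p.1, [arg min_(b < p.2) pot (p.1, b)]).

Fixpoint BRD (t : nat) (s : 'I_K * 'I_K) : 'I_K * 'I_K :=
  match t with
  | 0 => s
  | t'.+1 => let p := BRD t' s in if odd t' then stepB p else stepA p
  end.

(* basin of attraction of eta_j; empty if eta_j does not exist *)
Definition BoA (j : nat) : {set 'I_K * 'I_K} :=
  [set s | is_jth_PNE j (BRD (2 * K) s)].
End Game.

Definition expected_BoA_frac (R : realType) (K j : nat) : R :=
  (\sum_(f in bijective_potentials K) ((#|BoA f j|)%:R / K%:R))
    / (#|bijective_potentials K|)%:R.

(* Main.v *)
Require Import Defs.
From HB Require Import structures.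
From mathcomp Require Import all_boot all_order all_algebra perm.
From mathcomp Require Import all_classical all_reals all_analysis.
From mathcomp Require Import zify ring lra.
Import Order.TTheory GRing.Theory Num.Theory numFieldNormedType.Exports.

Set Implicit Arguments. Unset Strict Implicit. Unset Printing Implicit Defensive.

(* Reveal the cells in increasing order of potential. A cell whose row and column
   are both new is an equilibrium and starts a tree; a cell with exactly one new
   line attaches that line to the tree of the other line, because this is where the
   best response leads. Hence |BoA(eta_j)| = K * (number of columns in tree j).
   By exchangeability each new cell may be treated as uniform over all K^2 cells.
   If U rows and V columns are still new and a tree has X rows and Y columns, its
   expected final number of columns is an explicit combination of falling
   factorials: U^_i V^_j is an eigenvector of the chain with eigenvalue
   -(K(i+j) - ij). At X = Y = 1 the combination is close to exp(w) when
   U/K and V/K are close to w. Finally, U - V and N + (UV - K^2)/(2K-1), N being the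
   number of trees, have fluctuations of order sqrt K, so that U/K and V/K are close
   to w = sqrt(1 - 2 eps) when tree number eps K appears. This concentration enters
   through a quadratic supermartingale. *)

(** * Exploration of the potential and best-response dynamics *)

Section Exploration.
Variable K : nat.
Local Notation cell := ('I_K * 'I_K)%type.

(* Label 0 marks a row or column with no revealed cell; label t > 0 marks the
   lines whose best-response path ends at the t-th equilibrium. *)
Record labelling := Labelling {
  ntrees : nat;
  row_label : {ffun 'I_K -> nat};
  col_label : {ffun 'I_K -> nat} }.

Definition set_label (g : {ffun 'I_K -> nat}) (i : 'I_K) (l : nat) :=
  [ffun a => if (g a == 0) && (a == i) then l else g a].

(** When both lines already carry labels, [set_label] leaves them alone, so [l] matters only when at
    least one line is new. *)
Definition reveal (st : labelling) (x : cell) : labelling :=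
  let r := row_label st x.1 in
  let c := col_label st x.2 in
  let l := if r != 0 then r else if c != 0 then c else (ntrees st).+1 in
  Labelling (ntrees st + ((r == 0) && (c == 0)))
    (set_label (row_label st) x.1 l) (set_label (col_label st) x.2 l).

Definition unlabelled := Labelling 0 [ffun=> 0] [ffun=> 0].

(** After [n] steps the cells of potential below [n] have been revealed. For injective [f] the pick
    is unique, and it fails only at ranks from K^2 on. *)
Fixpoint explore (f : potential K) (n : nat) : labelling :=
  if n is n'.+1 then
    if [pick x | f x == n' :> nat] is Some x then reveal (explore f n') x
    else explore f n'
  else unlabelled.

Definition label_count (g : {ffun 'I_K -> nat}) (k : nat) : nat :=
  \sum_a (g a == k).

Lemma set_label_id (g : {ffun 'I_K -> nat}) i l : g i != 0 -> set_label g i l = g.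
Proof.
move=> gi; apply/ffunP => a; rewrite ffunE; case: eqP => //= ga.
by case: eqP => // ai; rewrite -ai ga eqxx in gi.
Qed.

Lemma reveal_id st x : row_label st x.1 != 0 -> col_label st x.2 != 0 ->
  reveal st x = st.
Proof.
move=> r0 c0; rewrite /reveal !set_label_id // (negPf r0) /= addn0.
by case: st {r0 c0}.
Qed.

Lemma label_count0 (g : {ffun 'I_K -> nat}) i l : l != 0 ->
  label_count (set_label g i l) 0 = label_count g 0 - (g i == 0).
Proof.
move=> l0; rewrite /label_count (bigD1 i) //= [in RHS](bigD1 i) //= addKn.
rewrite ffunE eqxx andbT; have -> : ((if g i == 0 then l else g i) == 0) = false.
  by case: (eqVneq (g i) 0) => [_|/negPf//]; apply: negPf.
by rewrite add0n; apply: eq_bigr => a ai; rewrite ffunE (negPf ai) andbF.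
Qed.

Lemma label_countS (g : {ffun 'I_K -> nat}) i l k : k != 0 ->
  label_count (set_label g i l) k = label_count g k + ((g i == 0) && (l == k)).
Proof.
move=> k0; rewrite /label_count (bigD1 i) //= [in RHS](bigD1 i) //=.
rewrite ffunE eqxx andbT addnAC; congr addn; last first.
  by apply: eq_bigr => a ai; rewrite ffunE (negPf ai) andbF.
case: (eqVneq (g i) 0) => [->|_] /=; last by rewrite addn0.
by rewrite [0 == k]eq_sym (negPf k0).
Qed.

Lemma label_count_le g k : label_count g k <= K.
Proof.
rewrite -[leqRHS]card_ord -sum1_card; apply: leq_sum => i _; exact: leq_b1.
Qed.

(** This guarantees that label j occurs nowhere before the j-th tree starts. *)
Definition wf_labelling st :=
  (forall a, row_label st a <= ntrees st) /\ (forall b, col_label st b <= ntrees st).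

Lemma wf_reveal st x : wf_labelling st -> wf_labelling (reveal st x).
Proof.
move=> [wr wc].
have hl : (if row_label st x.1 != 0 then row_label st x.1 else
    if col_label st x.2 != 0 then col_label st x.2 else (ntrees st).+1) <=
    ntrees st + ((row_label st x.1 == 0) && (col_label st x.2 == 0)).
  have := wr x.1; have := wc x.2.
  by case: (row_label st x.1 == 0); case: (col_label st x.2 == 0) => //=; rewrite ?addn0 ?addn1.
split=> i; rewrite /= ffunE; case: ifP => // _.
  exact: leq_trans (wr i) (leq_addr _ _).
exact: leq_trans (wc i) (leq_addr _ _).
Qed.

Lemma wf_explore f n : wf_labelling (explore f n).
Proof.
elim: n => [|n IH] /=; first by split=> i; rewrite ffunE.
by case: pickP => // x _; apply: wf_reveal.
Qed.

Section FixedPotential.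
Variable f : potential K.
Hypothesis f_inj : injective f.

Lemma exploreS x : explore f (f x).+1 = reveal (explore f (f x)) x.
Proof.
rewrite /=; case: pickP => [y /eqP fy|/(_ x)]; last by rewrite eqxx.
by congr reveal; apply/f_inj/val_inj.
Qed.

Lemma row_label_mono m n a : m <= n -> row_label (explore f m) a != 0 ->
  row_label (explore f n) a = row_label (explore f m) a.
Proof.
elim: n => [|n IH]; first by rewrite leqn0 => /eqP ->.
rewrite leq_eqVlt => /orP[/eqP -> //|]; rewrite ltnS => mn h.
rewrite /=; case: pickP => [x _|_]; last exact: IH.
by rewrite /= ffunE IH // (negPf h).
Qed.

Lemma col_label_mono m n b : m <= n -> col_label (explore f m) b != 0 ->
  col_label (explore f n) b = col_label (explore f m) b.
Proof.
elim: n => [|n IH]; first by rewrite leqn0 => /eqP ->.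
rewrite leq_eqVlt => /orP[/eqP -> //|]; rewrite ltnS => mn h.
rewrite /=; case: pickP => [x _|_]; last exact: IH.
by rewrite /= ffunE IH // (negPf h).
Qed.

Lemma reveal_labels st (x : cell) (l := row_label (reveal st x) x.1) :
  [/\ l != 0, col_label (reveal st x) x.2 = l \/ row_label st x.1 != 0 /\
      col_label st x.2 != 0
    & row_label st x.1 = 0 -> col_label st x.2 = 0 -> l = (ntrees st).+1].
Proof.
rewrite /l /= !ffunE !eqxx !andbT.
case: (eqVneq (row_label st x.1) 0) => [->|r0] /=;
  case: (eqVneq (col_label st x.2) 0) => [->|c0] /=; split=> //; try by left.
- by move=> _ e; rewrite e in c0.
- by move=> e; rewrite e in r0.
- by right.
- by move=> e; rewrite e in r0.
Qed.

Lemma reveal_col_label_neq0 st (x : cell) : col_label (reveal st x) x.2 != 0.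
Proof.
rewrite /= !ffunE !eqxx !andbT.
case: (eqVneq (row_label st x.1) 0) => [_|r0] /=;
  by case: (eqVneq (col_label st x.2) 0) => [_|c0] //=.
Qed.

(** Each reveal leaves both lines of its cell labelled, and labels persist; conversely a line
    receives its label only from one of its own cells. *)
Lemma row_label_eq0 n a :
  (row_label (explore f n) a == 0) = [forall b, n <= f (a, b)].
Proof.
apply/idP/forallP => [/eqP h b|h].
  rewrite leqNgt; apply/negP => lt.
  have [h1 _ _] := reveal_labels (explore f (f (a, b))) (a, b).
  by have := row_label_mono (a := a) lt; rewrite exploreS h => /(_ h1) e; rewrite -e in h1.
elim: n h => [|n IH] h; first by rewrite ffunE.
have {}IH : row_label (explore f n) a == 0 by apply: IH => b; apply: ltnW.
rewrite /=; case: pickP => // x /eqP fx; rewrite /= ffunE.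
case: (a =P x.1) => [ax|_]; last by rewrite andbF.
by have := h x.2; rewrite ax -surjective_pairing fx ltnn.
Qed.

Lemma col_label_eq0 n b :
  (col_label (explore f n) b == 0) = [forall a, n <= f (a, b)].
Proof.
apply/idP/forallP => [/eqP h a|h].
  rewrite leqNgt; apply/negP => lt.
  have h1 := reveal_col_label_neq0 (explore f (f (a, b))) (a, b).
  by have := col_label_mono (b := b) lt; rewrite exploreS h => /(_ h1) e; rewrite -e in h1.
elim: n h => [|n IH] h; first by rewrite ffunE.
have {}IH : col_label (explore f n) b == 0 by apply: IH => a; apply: ltnW.
rewrite /=; case: pickP => // x /eqP fx; rewrite /= ffunE.
case: (b =P x.2) => [ax|_]; last by rewrite andbF.
by have := h x.1; rewrite ax -surjective_pairing fx ltnn.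
Qed.

Lemma isPNE_label p : isPNE f p =
  (row_label (explore f (f p)) p.1 == 0) && (col_label (explore f (f p)) p.2 == 0).
Proof. by rewrite /isPNE row_label_eq0 col_label_eq0 andbC. Qed.

Lemma ntrees_explore n : ntrees (explore f n) = #|[set q | isPNE f q & f q < n]|.
Proof.
elim: n => [|n IH].
  by symmetry; apply: eq_card0 => q; rewrite !inE andbF.
rewrite /=; case: pickP => [x /eqP fx|nx]; last first.
  by rewrite IH; apply: eq_card => q; rewrite !inE ltnS [f q <= n]leq_eqVlt nx orFb.
rewrite /= IH -fx -isPNE_label.
rewrite (cardsD1 x [set q | isPNE f q & f q < (f x).+1]) !inE ltnSn andbT addnC.
congr addn; apply: eq_card => q; rewrite !inE ltnS [f q <= f x]leq_eqVlt.
case: (eqVneq q x) => [->|qx] /=; first by rewrite ltnn andbF.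
suff -> : (f q == f x :> nat) = false by [].
by apply/eqP => e; move/eqP: qx; apply; apply/f_inj/val_inj.
Qed.

Definition final_label := explore f (K * K).
Local Notation rho := (row_label final_label).
Local Notation kap := (col_label final_label).

Lemma row_label_final_neq0 a : rho a != 0.
Proof.
rewrite row_label_eq0; apply/forallP => /(_ a).
by rewrite leqNgt ltn_ord.
Qed.

Lemma col_label_final_neq0 b : kap b != 0.
Proof.
rewrite col_label_eq0; apply/forallP => /(_ b).
by rewrite leqNgt ltn_ord.
Qed.

Lemma final_labelE (x : cell) :
  rho x.1 = row_label (explore f (f x).+1) x.1 /\
  kap x.2 = col_label (explore f (f x).+1) x.2.
Proof.
split.
  apply: row_label_mono; first exact: ltn_ord.
  by rewrite exploreS; have [] := reveal_labels (explore f (f x)) x.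
apply: col_label_mono; first exact: ltn_ord.
by rewrite exploreS; apply: reveal_col_label_neq0.
Qed.

(** A line minimum finds its line new when it is revealed, so its row and column leave that step
    with a common label, which is final. *)
Lemma line_min_label (x : cell) :
  (forall a, f x <= f (a, x.2)) \/ (forall b, f x <= f (x.1, b)) ->
  kap x.2 = rho x.1.
Proof.
move=> xmin; have [-> ->] := final_labelE x; rewrite exploreS.
have [_ [//|[r0 c0]] _] := reveal_labels (explore f (f x)) x.
by case: xmin => /forallP; rewrite -(row_label_eq0, col_label_eq0) ?(negPf r0) ?(negPf c0).
Qed.

(** Both lines are new when an equilibrium is revealed, so it opens a tree whose number is its rank
    among the equilibria. *)
Lemma PNE_label p : isPNE f p ->
  kap p.2 = #|[set q | isPNE f q & f q < f p]|.+1.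
Proof.
move=> pne; have /andP[/forallP pA _] := pne.
rewrite line_min_label; last by left.
have [-> _] := final_labelE p; rewrite exploreS -ntrees_explore.
have [_ _] := reveal_labels (explore f (f p)) p; apply.
- by move: pne; rewrite isPNE_label => /andP[/eqP].
- by move: pne; rewrite isPNE_label => /andP[_ /eqP].
Qed.

(** * Best-response paths and their absorption *)

Lemma stepA_min p a : f (stepA f p) <= f (a, p.2).
Proof. by rewrite /stepA; case: arg_minnP => // i _ h; apply: h. Qed.

Lemma stepB_min p b : f (stepB f p) <= f (p.1, b).
Proof. by rewrite /stepB; case: arg_minnP => // i _ h; apply: h. Qed.

(** The invariant is the label of the line inside which the next move takes place: the current
    column at even times, the current row at odd times. The move ends at the minimum of that line,
    where row and column share a label. *)
Lemma BRD_label t s :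
  (if odd t then rho (BRD f t s).1 else kap (BRD f t s).2) = kap s.2.
Proof.
elim: t => //= t <-; case: (odd t) => /=.
  by rewrite (line_min_label (x := stepB f _)) //; right=> b; apply: stepB_min.
by rewrite -(line_min_label (x := stepA f _)) //; left=> a; apply: stepA_min.
Qed.

(* A strict BRD move leaves a line whose minimum lies above the new potential, so
   this count drops by at least one at every strict move. *)
Definition lines_below (p : cell) : nat :=
  #|[set a | [exists b, f (a, b) <= f p]]| + #|[set b | [exists a, f (a, b) <= f p]]|.

Lemma lines_below_ge2 p : 2 <= lines_below p.
Proof.
apply: (@leq_add 1 1); apply/card_gt0P.
  by exists p.1; rewrite inE; apply/existsP; exists p.2; rewrite -surjective_pairing.
by exists p.2; rewrite inE; apply/existsP; exists p.1; rewrite -surjective_pairing.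
Qed.

Lemma lines_below_row p q : f q < f p -> (forall b, f p <= f (p.1, b)) ->
  lines_below q < lines_below p.
Proof.
move=> qp pmin; rewrite /lines_below -addSn; apply: leq_add; last first.
  apply/subset_leq_card/fintype.subsetP => b; rewrite !inE => /existsP[a h].
  by apply/existsP; exists a; apply: leq_trans h (ltnW qp).
apply/proper_card/properP; split.
  apply/fintype.subsetP => a; rewrite !inE => /existsP[b h].
  by apply/existsP; exists b; apply: leq_trans h (ltnW qp).
exists p.1; rewrite inE; first by apply/existsP; exists p.2; rewrite -surjective_pairing.
by apply/existsP => -[b h]; have := leq_trans (leq_ltn_trans h qp) (pmin b); rewrite ltnn.
Qed.

Lemma lines_below_col p q : f q < f p -> (forall a, f p <= f (a, p.2)) ->
  lines_below q < lines_below p.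
Proof.
move=> qp pmin; rewrite /lines_below -addnS; apply: leq_add.
  apply/subset_leq_card/fintype.subsetP => a; rewrite !inE => /existsP[b h].
  by apply/existsP; exists b; apply: leq_trans h (ltnW qp).
apply/proper_card/properP; split.
  apply/fintype.subsetP => b; rewrite !inE => /existsP[a h].
  by apply/existsP; exists a; apply: leq_trans h (ltnW qp).
exists p.2; rewrite inE; first by apply/existsP; exists p.1; rewrite -surjective_pairing.
by apply/existsP => -[a h]; have := leq_trans (leq_ltn_trans h qp) (pmin a); rewrite ltnn.
Qed.

(** A move that does not lower the potential is no move, by injectivity, and the profile is then
    minimal in both lines. Every other move costs at least one unit of [lines_below], which is at
    most 2K. *)
Lemma BRD_progress t s (p := BRD f t.+1 s) :
  (if odd t then forall b, f p <= f (p.1, b) else forall a, f p <= f (a, p.2)) /\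
  (isPNE f p \/ lines_below p + t <= K + K).
Proof.
rewrite {}/p; elim: t => [|t [IHmin IH]].
  split; first exact: stepA_min.
  right; rewrite addn0; apply: leq_add; rewrite -[leqRHS]card_ord; exact: max_card.
have -> : BRD f t.+2 s = if odd t then stepA f (BRD f t.+1 s) else stepB f (BRD f t.+1 s).
  by rewrite [LHS]/= if_neg.
move: (BRD f t.+1 s) IHmin IH => p; rewrite [odd t.+1]/=.
case: (odd t) => pmin IH.
  split; first exact: stepA_min.
  have [lt|] := ltnP (f (stepA f p)) (f p).
    case: IH => [/andP[/forallP pA _]|IH].
      by move: lt; rewrite ltnNge (pA (stepA f p).1).
    by right; rewrite addnS -addSn; apply: leq_trans IH; rewrite leq_add2r lines_below_row.
  move=> le; have e : stepA f p = p.
    apply/f_inj/val_inj/eqP; rewrite eqn_leq le andbT.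
    by rewrite [in leqRHS](surjective_pairing p) stepA_min.
  left; rewrite e; apply/andP; split; apply/forallP => // a.
  by have := stepA_min p a; rewrite e.
split; first exact: stepB_min.
have [lt|] := ltnP (f (stepB f p)) (f p).
  case: IH => [/andP[_ /forallP pB]|IH].
    by move: lt; rewrite ltnNge (pB (stepB f p).2).
  by right; rewrite addnS -addSn; apply: leq_trans IH; rewrite leq_add2r lines_below_col.
move=> le; have e : stepB f p = p.
  apply/f_inj/val_inj/eqP; rewrite eqn_leq le andbT.
  by rewrite [in leqRHS](surjective_pairing p) stepB_min.
left; rewrite e; apply/andP; split; apply/forallP => // b.
by have := stepB_min p b; rewrite e.
Qed.

Lemma BRD_absorbed s : isPNE f (BRD f (2 * K) s).
Proof.
have K0 : 0 < K by case: s => [[a +] _]; case: K.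
(* With t = 2K - 1 the alternative to absorption says that [lines_below] is at most 1, against
   [lines_below_ge2]. *)
have -> : 2 * K = (2 * K).-1.+1 by lia.
have [_ []//] := BRD_progress (2 * K).-1 s.
by have := lines_below_ge2 (BRD f (2 * K).-1.+1 s); lia.
Qed.

(** Player A moves first, inside the starting column, so a basin consists of whole columns. As 2K is
    even, [BRD_label] equates the final column label with the starting one, and [PNE_label]
    identifies it with the rank. *)
Lemma card_BoA j : 0 < j -> #|BoA f j| = K * label_count kap j.
Proof.
move=> j0.
have -> : BoA f j = finset.setX [set a | true] [set b | kap b == j].
  apply/setP => -[a b]; rewrite !inE /= /is_jth_PNE j0 BRD_absorbed /=.
  rewrite -(PNE_label (BRD_absorbed _)).
  by have := BRD_label (2 * K) (a, b); rewrite oddM /= => ->.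
rewrite cardsX cardsE card_ord; congr muln.
by rewrite -sum1_card big_mkcond; apply: eq_bigr => b _; rewrite inE; case: eqP.
Qed.

End FixedPotential.
End Exploration.

Local Open Scope ring_scope.
Local Open Scope classical_set_scope.

(** * Expected growth of a tree *)

Section Growth.
Variable R : realFieldType.
Variable K : nat.

(* growth_rate k = K(i+j) - ij for i = k./2, j = uphalf k; minus this number is the
   eigenvalue of the exploration chain on the product U^_i V^_j. *)
Definition growth_rate (k : nat) : R := (k * K)%:R - (k./2 * uphalf k)%:R.

(** Dividing by the successive rates makes the one-step sum telescope. For fixed k and large K the
    rate is asymptotic to kK, hence the coefficient to 1/(k! K^k); this produces the exponential
    series. *)
Fixpoint growth_coef (k : nat) : R :=
  if k is k'.+1 then growth_coef k' / growth_rate k else 1.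

Definition growth_term (U V k : nat) : R :=
  growth_coef k * (U ^_ k./2)%:R * (V ^_ uphalf k)%:R.

(* Expected final number of columns of a tree that has X rows and Y columns when
   U rows and V columns are still unlabelled. *)
Definition growth (U V : nat) (X Y : R) : R :=
  \sum_(k < (2 * K).+1) (if odd k then X else Y) * growth_term U V k.

(** Here [k./2] is at most k/2 and [uphalf k] at most K. The bound keeps the denominators of
    [growth_coef] positive over the whole range of summation. *)
Lemma growth_rate_ge k : (k <= 2 * K)%N -> (k * K)%:R / 2 <= growth_rate k.
Proof.
move=> kK; rewrite /growth_rate.
suff : (2 * (k./2 * uphalf k) <= k * K)%N.
  rewrite -(ler_nat R) !natrM => h; lra.
have : (uphalf k <= K)%N by rewrite uphalf_half; lia.
have : (2 * k./2 <= k)%N by lia.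
nia.
Qed.

Lemma growth_rate_gt0 k : (0 < k <= 2 * K)%N -> 0 < growth_rate k.
Proof.
move=> /andP[k0 kK]; apply: lt_le_trans (growth_rate_ge kK).
by rewrite divr_gt0 // ltr0n muln_gt0 k0; lia.
Qed.

Lemma growth_coefS k : (k < 2 * K)%N ->
  growth_coef k.+1 * growth_rate k.+1 = growth_coef k.
Proof. by move=> kK; rewrite /= divfK // gt_eqF // growth_rate_gt0. Qed.

Lemma natr_ffact_pred U i : U%:R * (U.-1 ^_ i)%:R = (U%:R - i%:R) * (U ^_ i)%:R :> R.
Proof.
rewrite -natrM -ffactnS ffactnSr natrM mulrC.
case: (leqP i U) => h; first by rewrite natrB.
by rewrite ffact_small // !mulr0.
Qed.

Lemma growth_end X Y : growth 0 0 X Y = Y.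
Proof.
rewrite /growth big_ord_recl big1 ?addr0 => [|i _].
  by rewrite /growth_term /= !ffactn0 !mulr1.
by rewrite /growth_term lift0 (@ffact_small 0 (uphalf i.+1)) ?mulr0.
Qed.

(* One revealed cell picks its row and its column independently, so the sum over cells factors;
   U^_i V^_j is then an eigenvector and the shifted products feed the next term. *)
Lemma growth_step U V (X Y : R) : (U <= K)%N -> (V <= K)%N ->
  \sum_(k < (2 * K).+1) growth_coef k *
    ((if odd k then X else Y) * ((K%:R - k./2%:R) * (U ^_ k./2)%:R)
        * ((K%:R - (uphalf k)%:R) * (V ^_ uphalf k)%:R)
     + (if odd k then Y else X) * (U ^_ (k.+1)./2)%:R * (V ^_ (uphalf k.+1))%:R)
  = K%:R ^+ 2 * growth U V X Y.
Proof.
move=> UK VK.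
pose z k := if odd k then X else Y.
pose b k : R := (U ^_ k./2)%:R * (V ^_ uphalf k)%:R.
(* Each summand is K^2 times a growth term plus a difference that telescopes by [growth_coefS]. The
   boundary terms vanish: [growth_rate 0] is 0, and index 2K + 1 involves the falling factorial of V
   of order K + 1. *)
transitivity (\sum_(k < (2 * K).+1) (K%:R ^+ 2 * (z k * growth_term U V k) +
   ((growth_coef k * z k.+1 * b k.+1) -
    (growth_coef k * growth_rate k * z k * b k)))).
  apply: eq_bigr => k _; rewrite /growth_term /z /b /growth_rate.
  have -> : (if odd k.+1 then X else Y) = (if odd k then Y else X) by rewrite /=; case: odd.
  have -> : ((k : nat) * K)%:R = (k./2%:R + (uphalf k)%:R) * K%:R :> R.
    by rewrite -natrD -natrM; congr (_ * _)%:R; rewrite uphalf_half; lia.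
  rewrite natrM; ring.
rewrite big_split /= -mulr_sumr sumrB [X in _ + (_ - X)]big_ord_recl.
rewrite [X in _ + (X - _)]big_ord_recr /=.
have -> : b (2 * K).+1 = 0.
  by rewrite /b (@ffact_small V) ?mulr0 //= mul2n doubleK ltnS.
have -> : growth_rate 0 = 0 by rewrite /growth_rate /= !mul0n subrr.
rewrite !mulr0 !mul0r add0r addr0.
rewrite [X in _ + (X - _)](eq_bigr (fun i : 'I_(2 * K) => growth_coef (bump 0 i) * growth_rate (bump 0 i) * z (bump 0 i) * b (bump 0 i))) ?subrr ?addr0 //.
move=> i _; change (bump 0 i) with i.+1.
by rewrite -[growth_coef i](growth_coefS (ltn_ord i)).
Qed.

(** [tau] is the ratio of consecutive growth terms; it is compared with w / k, the ratio of
    consecutive terms of the series of exp w. *)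
Lemma growth_ratio_approx (W m k : nat) (w zeta : R)
    (tau := (W%:R - m%:R) / growth_rate k : R) :
  (0 < k <= 2 * K)%N -> (m <= K)%N -> (m <= k)%N -> (W <= K)%N -> 0 <= w <= 1 ->
  `|W%:R / K%:R - w| <= zeta ->
  `|tau| <= 2 / k%:R /\ `|tau - w / k%:R| <= 2 * (zeta + 2 * k%:R / K%:R) / k%:R.
Proof.
move=> k0K mK mk WK /andP[w0 w1] hW; have /andP[k0 kK] := k0K.
have [ik jk] : (k./2 <= k)%N /\ (uphalf k <= k)%N.
  by clear -k0; split; rewrite ?uphalf_half; lia.
have K0 : (0 < K)%N by clear -k0 kK; lia.
have kR : 0 < k%:R :> R by rewrite ltr0n.
have KR : 0 < K%:R :> R by rewrite ltr0n.
have rge := growth_rate_ge kK; have r0 := growth_rate_gt0 k0K.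
have tauE : tau = (W%:R - m%:R) / growth_rate k by [].
have rE : growth_rate k = k%:R * K%:R - (k./2 * uphalf k)%:R by rewrite -natrM.
clearbody tau; move: (growth_rate k) rE rge r0 tauE => r rE; rewrite natrM => rge r0 ->.
have mW : `|W%:R - m%:R| <= K%:R :> R.
  have : W%:R <= K%:R :> R by rewrite ler_nat.
  have : m%:R <= K%:R :> R by rewrite ler_nat.
  have : 0 <= W%:R :> R by exact: ler0n.
  have : 0 <= m%:R :> R by exact: ler0n.
  by move=> ? ? ? ?; rewrite ler_norml; apply/andP; split; lra.
have hm : m%:R <= k%:R :> R by rewrite ler_nat.
have m0 : 0 <= m%:R :> R by exact: ler0n.
have hij : (k./2 * uphalf k)%:R / k%:R <= k%:R :> R.
  by rewrite ler_pdivrMr // -natrM ler_nat leq_mul.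
have hij0 : 0 <= (k./2 * uphalf k)%:R / k%:R :> R by rewrite divr_ge0 // ler0n.
split.
  rewrite normrM normfV (gtr0_norm r0) ler_pdivrMr //.
  by apply: le_trans mW _; rewrite mulrAC ler_pdivlMr //; lra.
(* The numerator splits into W - wK, of size at most zeta K, and two errors of size at most k; the
   denominator is at least kK / 2. *)
have -> : (W%:R - m%:R) / r - w / k%:R =
    ((W%:R - w * K%:R) - m%:R + w * ((k./2 * uphalf k)%:R / k%:R)) / r.
  have r0' : k%:R * K%:R - (k./2 * uphalf k)%:R != 0 :> R by rewrite -rE gt_eqF.
  rewrite rE; move: (k./2 * uphalf k)%:R r0' => q r0'; field.
  by rewrite r0' gt_eqF.
rewrite normrM normfV (gtr0_norm r0) ler_pdivrMr //.
have hWK : `|W%:R - w * K%:R| <= zeta * K%:R.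
  by rewrite -ler_pdivrMr // -[X in _ / X](gtr0_norm KR) -normf_div mulrBl mulfK ?gt_eqF.
have z0 : 0 <= zeta by apply: le_trans hW; exact: normr_ge0.
have num : `|W%:R - w * K%:R - m%:R + w * ((k./2 * uphalf k)%:R / k%:R)| <=
    zeta * K%:R + k%:R + k%:R.
  move: hWK hij hij0; move: ((k./2 * uphalf k)%:R / k%:R) => q.
  rewrite !ler_norml => /andP[h1 h2] h3 h4.
  have h5 : 0 <= w * q by rewrite mulr_ge0.
  have h6 : w * q <= k%:R by apply: le_trans (ler_piMl h4 w1) h3.
  by apply/andP; split; lra.
apply: le_trans num _.
rewrite mulrAC ler_pdivlMr //.
have q0 : 0 <= zeta + 2 * k%:R / K%:R by rewrite addr_ge0 // divr_ge0 ?mulr_ge0 ?ler0n.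
apply: le_trans (ler_wpM2l _ rge); last by rewrite mulr_ge0.
rewrite le_eqVlt; apply/orP; left; apply/eqP; field.
by rewrite gt_eqF.
Qed.

Lemma growth_termS U V k (W := if odd k then U else V) :
  growth_term U V k.+1 = growth_term U V k * ((W%:R - k./2%:R) / growth_rate k.+1).
Proof.
rewrite /growth_term /W [growth_coef k.+1]/= [uphalf k.+1]/= [k.+1./2]/= uphalf_half.
case: (odd k); rewrite /= ?add0n ?add1n ffactnSr natrM.
  case: (leqP k./2 U) => h; first by rewrite natrB //; ring.
  by rewrite (@ffact_small U) // ?(mul0r, mulr0).
case: (leqP k./2 V) => h; first by rewrite natrB //; ring.
by rewrite (@ffact_small V) // ?(mul0r, mulr0).
Qed.

Lemma growth_term_approx (U V k : nat) (w zeta : R) :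
  (U <= K)%N -> (V <= K)%N -> (k <= 2 * K)%N -> 0 <= w <= 1 ->
  `|U%:R / K%:R - w| <= zeta -> `|V%:R / K%:R - w| <= zeta ->
  `|growth_term U V k - w ^+ k / k`!%:R| <=
    2 ^+ k / k`!%:R * (k%:R ^+ 2 * (zeta + 2 / K%:R)).
Proof.
move=> UK VK + w01 hU hV; have /andP[w0 w1] := w01.
have z0 : 0 <= zeta by apply: le_trans hU; exact: normr_ge0.
elim: k => [|k IH] kK.
  by rewrite /growth_term /= !expr0 fact0 !ffactn0 !mulr1 divr1 subrr normr0 mul1r expr0n mul0r.
have {}IH := IH (ltnW kK).
have K0 : (0 < K)%N by clear -kK; lia.
have KR : 0 < K%:R :> R by rewrite ltr0n.
have k1 : 0 < k.+1%:R :> R by rewrite ltr0n.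
have [|||||tau2 tauw] := @growth_ratio_approx (if odd k then U else V) k./2 k.+1 w zeta _ _ _ _ w01.
- by [].
- by clear -kK; lia.
- by clear; lia.
- by case: odd.
- by case: odd.
rewrite growth_termS.
move: (_ / growth_rate _) tau2 tauw => tau tau2 tauw.
move: (growth_term U V k) IH => t IH.
have sk : `|w ^+ k / k`!%:R| <= 1 / k`!%:R.
  rewrite normrM normfV normr_nat ler_pM2r ?invr_gt0 ?ltr0n ?fact_gt0 //.
  by rewrite normrX ger0_norm // exprn_ile1.
have fk : 0 < k`!%:R :> R by rewrite ltr0n fact_gt0.
rewrite factS natrM exprS.
(* The first part is the old error times at most 2 / (k + 1), whence the power of 2; the second is
   the error of the new ratio. *)
have -> : t * tau - w * w ^+ k / (k.+1%:R * k`!%:R) =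
   (t - w ^+ k / k`!%:R) * tau + w ^+ k / k`!%:R * (tau - w / k.+1%:R).
  by field; rewrite !gt_eqF.
apply: le_trans (ler_normD _ _) _; rewrite normrM [`|_ * (tau - _)|]normrM.
apply: le_trans (lerD (ler_pM _ _ IH tau2) (ler_pM _ _ sk tauw)) _ => //.
set e := zeta + 2 / K%:R.
have -> : 2 ^+ k / k`!%:R * (k%:R ^+ 2 * e) * (2 / k.+1%:R) +
  1 / k`!%:R * (2 * (zeta + 2 * k.+1%:R / K%:R) / k.+1%:R) =
  2 / (k.+1%:R * k`!%:R) * (2 ^+ k * k%:R ^+ 2 * e + (zeta + 2 * k.+1%:R / K%:R)).
  by field; rewrite !gt_eqF.
have -> : 2 ^+ k.+1 / (k.+1%:R * k`!%:R) * (k.+1%:R ^+ 2 * e) =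
  2 / (k.+1%:R * k`!%:R) * (2 ^+ k * k.+1%:R ^+ 2 * e).
  by rewrite exprS; field; rewrite !gt_eqF.
rewrite ler_pM2l ?divr_gt0 ?mulr_gt0 //.
have p2 : 1 <= 2 ^+ k :> R by rewrite exprn_ege1 // ler1n.
have K'0 : 0 < K%:R^-1 :> R by rewrite invr_gt0.
have k0 : 0 <= k%:R :> R by [].
have e0 : 0 <= e by rewrite /e; nra.
(* The new error must fit into the gap (k + 1)^2 - k^2 = 2k + 1. *)
suff : zeta + 2 * k.+1%:R / K%:R <= 2 ^+ k * ((2 * k%:R + 1) * e).
  rewrite -natr1 => h; apply: le_trans (lerD (lexx _) h) _.
  by rewrite -!mulrA -mulrDr le_eqVlt; apply/orP; left; apply/eqP; ring.
apply: (@le_trans _ _ ((2 * k%:R + 1) * e)); last by apply: ler_peMl => //; nra.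
by rewrite /e -natr1; nra.
Qed.
End Growth.

(** * Averaging over potentials *)

Section Average.
Variables (R : realFieldType) (K : nat).
Local Notation cell := ('I_K * 'I_K)%type.
Implicit Types st : labelling K.

(** Exchangeability of the cells is expressed by this involution, which preserves the set of
    bijective potentials. *)
Definition swap_ranks (m n : 'I_(K * K)) (f : potential K) : potential K :=
  [ffun x => tperm m n (f x)].

Lemma swap_ranksK m n : involutive (swap_ranks m n).
Proof. by move=> f; apply/ffunP => x; rewrite !ffunE tpermK. Qed.

Lemma swap_ranks_bij m n f :
  (swap_ranks m n f \in bijective_potentials K) = (f \in bijective_potentials K).
Proof.
have h g : g \in bijective_potentials K -> swap_ranks m n g \in bijective_potentials K.
  rewrite !inE => /injectiveP g_inj; apply/injectiveP => x y.
  by rewrite !ffunE => /perm_inj /g_inj.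
by apply/idP/idP => [/h|/h //]; rewrite swap_ranksK.
Qed.

Lemma explore_swap (m n : 'I_(K * K)) f k : (m <= n)%N -> (k <= m)%N ->
  explore (swap_ranks m n f) k = explore f k.
Proof.
move=> mn; elim: k => //= k IH km; rewrite IH ?(ltnW km) //.
rewrite (@eq_pick _ _ (fun x => f x == k :> nat)) // => x; rewrite ffunE.
by case: tpermP => [->|->|//]; apply/eqP/eqP; lia.
Qed.

(* The cell of rank n is exchangeable with those of higher rank, and revealing a cell of
   lower rank again changes nothing; hence it may be replaced by a uniform cell. *)
Lemma average_step (phi : labelling K -> R) n : (n < K * K)%N ->
  (forall st, wf_labelling st -> \sum_x phi (reveal st x) <= K%:R ^+ 2 * phi st) ->
  \sum_(f in bijective_potentials K) phi (explore f n.+1) <=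
  \sum_(f in bijective_potentials K) phi (explore f n).
Proof.
move=> nK phi_step.
(* [H f m] evaluates [phi] when the cell of rank m, instead of rank n, is revealed after n steps;
   [T m] sums this over the potentials. *)
pose H (f : potential K) (m : 'I_(K * K)) := phi (if [pick x | f x == m :> nat] is Some x
  then reveal (explore f n) x else explore f n).
pose T m := \sum_(f in bijective_potentials K) H f m.
set S := leRHS; pose n0 := Ordinal nK.
have Tge (m : 'I_(K * K)) : (n <= m)%N -> T m = T n0.
  move=> nm; rewrite /T (reindex_inj (inv_inj (swap_ranksK n0 m))) /=.
  rewrite (eq_bigl _ _ (swap_ranks_bij n0 m)); apply: eq_bigr => f _.
  rewrite /H (@explore_swap n0 m) //.
  rewrite (@eq_pick _ _ (fun x => f x == n :> nat)) // => x; rewrite ffunE.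
  case: tpermP => [->|->|h1 h2]; [by rewrite !eqxx|by rewrite eq_sym|].
  by apply/eqP/eqP => e; [case: h2 | case: h1]; apply: val_inj.
have Tlt (m : 'I_(K * K)) : (m < n)%N -> T m = S.
  move=> mn; apply: eq_bigr => f; rewrite inE => /injectiveP f_inj.
  rewrite /H; case: pickP => // x /eqP fx; rewrite reveal_id //.
    rewrite row_label_eq0 //; apply/forallP => /(_ x.2).
    by rewrite -surjective_pairing fx leqNgt mn.
  rewrite col_label_eq0 //; apply/forallP => /(_ x.1).
  by rewrite -surjective_pairing fx leqNgt mn.
have -> : \sum_(f in bijective_potentials K) phi (explore f n.+1) = T n0.
  by apply: eq_bigr => f _; rewrite /H /=; case: pickP.
(* Summing over all ranks is summing over all cells since [f] is a bijection, so the one-step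
   hypothesis applies. *)
have sumT : \sum_m T m <= K%:R ^+ 2 * S.
  rewrite /T exchange_big /= mulr_sumr; apply: ler_sum => f.
  rewrite inE => /injectiveP f_inj.
  have f_bij : bijective f by apply: inj_card_bij => //; rewrite card_prod !card_ord.
  rewrite (reindex f) /=; last exact: onW_bij.
  apply: le_trans (phi_step _ (wf_explore _ _)); rewrite le_eqVlt; apply/orP; left.
  apply/eqP/eq_bigr => x _; rewrite /H; case: pickP => [y /eqP fy|/(_ x)]; last by rewrite eqxx.
  by congr (phi (reveal _ _)); apply/f_inj/val_inj.
(* Here n ranks contribute [S] and K^2 - n contribute [T n0]; it remains to cancel n S and divide by
   K^2 - n > 0. *)
have := sumT; rewrite (bigID (fun m : 'I_(K * K) => (m < n)%N)) /=.
rewrite (eq_bigr _ Tlt) [X in _ + X](eq_bigr (fun=> T n0)); last first.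
  by move=> m; rewrite -leqNgt; apply: Tge.
rewrite !sumr_const -[S *+ _]mulr_natl -[T n0 *+ _]mulr_natl.
have card_lt : #|[pred m : 'I_(K * K) | (m < n)%N]| = n.
  by rewrite -sum1_card -(big_ord_widen _ (fun=> 1%N)) ?sum_nat_const ?card_ord ?muln1 // ltnW.
have -> : #|[pred m : 'I_(K * K) | ~~ (m < n)%N]| = (K * K - n)%N.
  apply: (@addnI n); rewrite subnKC ?(ltnW nK) // -{1}card_lt -[RHS]card_ord.
  exact: cardC.
rewrite card_lt natrB ?(ltnW nK) // natrM => h.
have p : 0 < K%:R * K%:R - n%:R :> R by rewrite subr_gt0 -natrM ltr_nat.
rewrite -(ler_pM2l p); nra.
Qed.

Lemma average_explore (phi : labelling K -> R) :
  (forall st, wf_labelling st -> \sum_x phi (reveal st x) <= K%:R ^+ 2 * phi st) ->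
  \sum_(f in bijective_potentials K) phi (final_label f) <=
  #|bijective_potentials K|%:R * phi (unlabelled K).
Proof.
move=> phi_step; rewrite /final_label.
suff h n : (n <= K * K)%N -> \sum_(f in bijective_potentials K) phi (explore f n) <=
    #|bijective_potentials K|%:R * phi (unlabelled K) by exact: h.
elim: n => [_|n IH nK].
  by rewrite /= sumr_const mulr_natl.
exact: le_trans (average_step nK phi_step) (IH (ltnW nK)).
Qed.

(** * Sums over one uniformly chosen cell *)

Lemma sum_label_countr (g : {ffun 'I_K -> nat}) k :
  \sum_a (g a == k)%:R = (label_count g k)%:R :> R.
Proof. by rewrite /label_count natr_sum. Qed.

Lemma ffact_label (g : {ffun 'I_K -> nat}) i a (U := label_count g 0) :
  ((U - (g a == 0%N)) ^_ i)%:R =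
  (U ^_ i)%:R + (g a == 0%N)%:R * ((U.-1 ^_ i)%:R - (U ^_ i)%:R) :> R.
Proof.
case: (g a == 0%N); first by rewrite subn1 mul1r addrC subrK.
by rewrite subn0 mul0r addr0.
Qed.

(** Half of the eigenvector relation: rows and columns together give the eigenvalue (K - i)(K - j) -
    K^2. *)
Lemma sum_ffact_label (g : {ffun 'I_K -> nat}) i (U := label_count g 0) :
  \sum_a ((U - (g a == 0%N)) ^_ i)%:R = (K%:R - i%:R) * (U ^_ i)%:R :> R.
Proof.
rewrite (eq_bigr _ (fun a _ => ffact_label g i a)) big_split /= -mulr_suml.
rewrite sum_label_countr sumr_const card_ord mulrBr natr_ffact_pred -/U -mulr_natl; ring.
Qed.

(** A new line can be chosen in U ways and leaves U - 1, which raises the order of the falling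
    factorial; this feeds the next growth term. *)
Lemma sum_ffact_label0 (g : {ffun 'I_K -> nat}) i (U := label_count g 0) :
  \sum_a (g a == 0%N)%:R * ((U - (g a == 0%N)) ^_ i)%:R = (U ^_ i.+1)%:R :> R.
Proof.
rewrite ffactnS natrM -sum_label_countr mulr_suml; apply: eq_bigr => a _.
by case: (g a == 0%N); rewrite ?mul0r // subn1.
Qed.

Lemma sum_ffact_labelS (g : {ffun 'I_K -> nat}) i j (U := label_count g 0) : (0 < j)%N ->
  \sum_a (g a == j)%:R * ((U - (g a == 0%N)) ^_ i)%:R =
  (label_count g j)%:R * (U ^_ i)%:R :> R.
Proof.
move=> j0; rewrite -sum_label_countr mulr_suml; apply: eq_bigr => a _.
case: (eqVneq (g a) j) => [->|_]; last by rewrite !mul0r.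
by rewrite [j == 0%N]eqn0Ngt j0 subn0.
Qed.

Lemma sum_cells (F G : 'I_K -> R) :
  \sum_(x : cell) F x.1 * G x.2 = (\sum_a F a) * (\sum_b G b).
Proof. by rewrite big_distrlr /= pair_big. Qed.

Definition tree_growth j st : R :=
  growth K (label_count (row_label st) 0) (label_count (col_label st) 0)
    (label_count (row_label st) j)%:R (label_count (col_label st) j)%:R.

Lemma reveal_count0 st x :
  label_count (row_label (reveal st x)) 0 =
    (label_count (row_label st) 0 - (row_label st x.1 == 0%N))%N /\
  label_count (col_label (reveal st x)) 0 =
    (label_count (col_label st) 0 - (col_label st x.2 == 0%N))%N.
Proof.
split; rewrite /= label_count0 //.
  by case: (eqVneq (row_label st x.1) 0%N) => // _; case: (eqVneq (col_label st x.2) 0%N).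
by case: (eqVneq (row_label st x.1) 0%N) => // _; case: (eqVneq (col_label st x.2) 0%N).
Qed.

Lemma reveal_countS st x j : (0 < j)%N ->
  label_count (row_label (reveal st x)) j =
    (label_count (row_label st) j + (row_label st x.1 == 0%N) *
     ((col_label st x.2 == j) + (col_label st x.2 == 0%N) * ((ntrees st).+1 == j)))%N /\
  label_count (col_label (reveal st x)) j =
    (label_count (col_label st) j + (col_label st x.2 == 0%N) *
     ((row_label st x.1 == j) + (row_label st x.1 == 0%N) * ((ntrees st).+1 == j)))%N.
Proof.
move=> j0; have j1 : j != 0%N by rewrite -lt0n.
have j2 : (0%N == j) = false by rewrite eq_sym; apply: negPf.
by split; rewrite /= label_countS //; congr addn;
  case: (eqVneq (row_label st x.1) 0%N) => [er|r0] //=;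
  case: (eqVneq (col_label st x.2) 0%N) => [ec|c0] //=;
  rewrite ?er ?ec /= ?j2 ?mul1n ?mul0n ?addn0 ?add0n.
Qed.

(** Once tree j exists no cell can start it again, so it grows only by attachment and [growth_step]
    makes its predicted size an exact martingale. *)
Lemma tree_growth_step j st : (0 < j <= ntrees st)%N ->
  \sum_x tree_growth j (reveal st x) = K%:R ^+ 2 * tree_growth j st.
Proof.
move=> /andP[j0 jN].
have Nj : ((ntrees st).+1 == j) = false by apply/eqP; lia.
rewrite -growth_step ?label_count_le // exchange_big /=.
apply: eq_bigr => k _; rewrite /growth_term.
set U := label_count (row_label st) 0; set V := label_count (col_label st) 0.
pose P a : R := ((U - (row_label st a == 0%N)) ^_ k./2)%:R.
pose Q b : R := ((V - (col_label st b == 0%N)) ^_ (uphalf k))%:R.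
rewrite -sum_ffact_label -sum_ffact_label -/U -/V -/P -/Q.
(* Terms with odd k carry the row count, which grows when a new row meets a column of tree j; even k
   is the symmetric case. *)
transitivity (growth_coef R K k * \sum_(x : cell)
    ((if odd k then (label_count (row_label st) j)%:R else (label_count (col_label st) j)%:R)
       * P x.1 * Q x.2 +
     (if odd k then ((row_label st x.1 == 0%N)%:R * P x.1) * ((col_label st x.2 == j)%:R * Q x.2)
      else ((row_label st x.1 == j)%:R * P x.1) * ((col_label st x.2 == 0%N)%:R * Q x.2)))).
  rewrite mulr_sumr; apply: eq_bigr => x _.
  have [-> ->] := reveal_count0 st x; have [-> ->] := reveal_countS st x j0.
  rewrite Nj !muln0 !addn0 -/(P x.1) -/(Q x.2) !natrD !natrM.
  by case: odd; ring.
congr (_ * _); rewrite big_split /=; congr (_ + _).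
  by rewrite (sum_cells (fun a => _ * P a)) -mulr_sumr.
case ok : (odd k).
  refine (etrans (sum_cells (fun a => (row_label st a == 0%N)%:R * P a)
    (fun b => (col_label st b == j)%:R * Q b)) _).
  rewrite /P /Q sum_ffact_label0 sum_ffact_labelS // -/V uphalf_half ok /=.
  by rewrite mulrCA mulrA add1n.
refine (etrans (sum_cells (fun a => (row_label st a == j)%:R * P a)
  (fun b => (col_label st b == 0%N)%:R * Q b)) _).
by rewrite /P /Q sum_ffact_label0 sum_ffact_labelS // -/U uphalf_half ok.
Qed.

End Average.

(** * Concentration *)

Section Deviation.
Variables (R : realFieldType) (K : nat).
Local Notation cell := ('I_K * 'I_K)%type.
Implicit Types st : labelling K.

(* With U unlabelled rows, V unlabelled columns and N trees, this quantity is an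
   exact martingale of the exploration. *)
Definition tree_excess (N U V : R) : R := N + (U * V - K%:R ^+ 2) / (2 * K%:R - 1).

(* Every revealed cell that labels a line decreases U + V by at least one, which
   pays for the quadratic variation of the two squares. *)
Definition deviation (N U V : R) : R :=
  (U - V) ^+ 2 + tree_excess N U V ^+ 2 + 2 * (U + V).

(** The flags r and c tell whether the row and the column are new. First-order terms are kept
    exactly, to be averaged over the cell later; only the squares of the increments are
    estimated. *)
Lemma deviation_reveal (N U V : R) (r c : bool) (D := 2 * K%:R - 1) :
  (0 < K)%N -> 0 <= U <= K%:R -> 0 <= V <= K%:R -> (r -> 1 <= U) -> (c -> 1 <= V) ->
  deviation (N + (r && c)%:R) (U - r%:R) (V - c%:R) <=
    deviation N U V
    + r%:R * (- (2 * (U - V)) - 2 * tree_excess N U V * V / D)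
    + c%:R * (2 * (U - V) - 2 * tree_excess N U V * U / D)
    + r%:R * c%:R * (2 * tree_excess N U V * (1 + D^-1)).
Proof.
move=> K0 /andP[U0 UK] /andP[V0 VK] rU cV.
have K1 : 1 <= K%:R :> R by rewrite ler1n.
have D1 : 1 <= D by rewrite /D; lra.
have Di0 : 0 < D^-1 by rewrite invr_gt0; lra.
pose A := tree_excess N U V.
pose Delta : R := r%:R * c%:R * (1 + D^-1) - (r%:R * V + c%:R * U) / D.
have eA : tree_excess (N + (r && c)%:R) (U - r%:R) (V - c%:R) = A + Delta.
  rewrite /A /Delta /tree_excess -/D -mulnb natrM; ring.
have uD : U / D <= 1 by rewrite ler_pdivrMr /D; lra.
have vD : V / D <= 1 by rewrite ler_pdivrMr /D; lra.
have u0 : 0 <= U / D by rewrite mulr_ge0 // ltW.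
have v0 : 0 <= V / D by rewrite mulr_ge0 // ltW.
(* [Delta] is the increment of [tree_excess]. With one new line both squares are at most 1; with
   two, the first is 0 and [Delta] lies in [0, 1]. *)
have Delta2 : (r%:R - c%:R) ^+ 2 + Delta ^+ 2 <= 2 * (r%:R + c%:R).
  rewrite /Delta; case: r rU {eA Delta} => [/(_ isT) U1|_]; case: c cV => [/(_ isT) V1|_];
    rewrite /= ?(mulr1, mul1r, mul0r, mulr0, add0r, addr0, subr0, sub0r, subrr, oppr0, expr0n) //=.
  - have -> : 1 + D^-1 - (V + U) / D = 1 - (U / D + V / D - D^-1) by ring.
    have h1 : D^-1 <= U / D by rewrite -[leLHS]mul1r ler_pM2r.
    have h2 : U / D + V / D - D^-1 <= 1.
      have -> : 1 = D / D by rewrite divff // gt_eqF //; lra.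
      rewrite -mulrDl -[X in _ - X]mul1r -mulrBl ler_pM2r // /D; lra.
    by nra.
  - by nra.
  - by nra.
rewrite /deviation eA -/A.
have -> : (U - r%:R - (V - c%:R)) ^+ 2 + (A + Delta) ^+ 2 + 2 * (U - r%:R + (V - c%:R)) =
  (U - V) ^+ 2 + A ^+ 2 + 2 * (U + V) - 2 * (U - V) * (r%:R - c%:R) + 2 * A * Delta
  + ((r%:R - c%:R) ^+ 2 + Delta ^+ 2 - 2 * (r%:R + c%:R)) by ring.
apply: le_trans (lerD (lexx _) (_ : _ <= 0)) _; first by rewrite subr_le0.
rewrite le_eqVlt; apply/orP; left; apply/eqP; rewrite /Delta; ring.
Qed.

Definition label_deviation st : R :=
  deviation (ntrees st)%:R (label_count (row_label st) 0)%:R (label_count (col_label st) 0)%:R.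

Lemma label_count_gt0 (g : {ffun 'I_K -> nat}) a k : g a = k -> (0 < label_count g k)%N.
Proof. by move=> ga; rewrite /label_count (bigD1 a) //= ga eqxx. Qed.

Lemma label_deviation_step st : (0 < K)%N ->
  \sum_x label_deviation (reveal st x) <= K%:R ^+ 2 * label_deviation st.
Proof.
move=> K0.
set U := label_count (row_label st) 0; set V := label_count (col_label st) 0.
pose A := tree_excess (ntrees st)%:R U%:R V%:R.
pose D : R := 2 * K%:R - 1.
pose r a : R := (row_label st a == 0%N)%:R.
pose c b : R := (col_label st b == 0%N)%:R.
pose alpha := - (2 * (U%:R - V%:R)) - 2 * A * V%:R / D.
pose beta := 2 * (U%:R - V%:R) - 2 * A * U%:R / D.
pose gamma := 2 * A * (1 + D^-1).
have bound01 (g : {ffun 'I_K -> nat}) : 0 <= (label_count g 0)%:R <= (K%:R : R).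
  by rewrite ler0n ler_nat label_count_le.
apply: (@le_trans _ _ (\sum_(x : cell) (label_deviation st + r x.1 * alpha + c x.2 * beta
    + r x.1 * c x.2 * gamma))).
  apply: ler_sum => x _; rewrite /label_deviation; have [-> ->] := reveal_count0 st x.
  have hr : row_label st x.1 == 0%N -> 1 <= U%:R :> R.
    by move=> /eqP /label_count_gt0; rewrite ler1n.
  have hc : col_label st x.2 == 0%N -> 1 <= V%:R :> R.
    by move=> /eqP /label_count_gt0; rewrite ler1n.
  rewrite natrD !natrB; first by apply: deviation_reveal; rewrite ?bound01.
    by move: hc; rewrite ler1n; case: eqP => // _; apply.
  by move: hr; rewrite ler1n; case: eqP => // _; apply.
move: (label_deviation st) => L.
have sr : \sum_a r a = U%:R by rewrite sum_label_countr.
have sc : \sum_b c b = V%:R by rewrite sum_label_countr.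
have s1 : \sum_(a : 'I_K) 1 = K%:R :> R by rewrite sumr_const card_ord.
have srx : \sum_(x : cell) r x.1 = U%:R * K%:R.
  rewrite -sr -s1 -sum_cells; by apply: eq_bigr => x _; rewrite mulr1.
have scx : \sum_(x : cell) c x.2 = K%:R * V%:R.
  rewrite -sc -s1 -sum_cells; by apply: eq_bigr => x _; rewrite mul1r.
rewrite !big_split /= -!mulr_suml srx scx sum_cells sr sc sumr_const card_prod card_ord.
rewrite -[_ *+ (K * K)]mulr_natl natrM /alpha /beta /gamma.
have D0 : D != 0.
  have K1 : 1 <= K%:R :> R by rewrite ler1n.
  by rewrite gt_eqF // /D; lra.
(* On summation the contributions of [tree_excess] cancel because D + 1 = 2K, and those of U - V
   combine to a nonpositive drift. *)
apply: (@le_trans _ _ (K%:R ^+ 2 * L - 2 * K%:R * (U%:R - V%:R) ^+ 2)).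
  by rewrite le_eqVlt; apply/orP; left; apply/eqP; rewrite /D in D0 *; field.
by rewrite lerBlDr lerDl mulr_ge0 ?sqr_ge0 // mulr_ge0.
Qed.

(* [s] is a sign, so that one statement gives both the upper and the lower bound. *)
Lemma sum_final_label_le j (s c delta C : R) : (0 < K)%N -> (0 < j)%N -> 0 <= C ->
  (forall U V, (U <= K)%N -> (V <= K)%N ->
     s * growth K U V 1 1 <= s * c + delta + C * deviation j%:R U%:R V%:R) ->
  (forall N, (N < j)%N -> 0 <= s * c + delta + C * deviation N%:R 0 0) ->
  s * \sum_(f in bijective_potentials K) (label_count (col_label (final_label f)) j)%:R <=
  #|bijective_potentials K|%:R * (s * c + delta + C * (4 * K%:R)).
Proof.
move=> K0 j0 C0 hgrow hend.
(* Before tree j starts, [phi] is the target bound carried by the deviation; afterwards it is the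
   signed martingale [tree_growth]. At the switch, [hgrow] bounds the new value by the old
   formula. *)
pose phi st := if (ntrees st < j)%N then s * c + delta + C * label_deviation st
  else s * tree_growth R j st.
have phi_step st : wf_labelling st -> \sum_x phi (reveal st x) <= K%:R ^+ 2 * phi st.
  move=> [wr wc]; rewrite /phi; case: (ltnP (ntrees st) j) => Nj; last first.
    rewrite mulrCA -tree_growth_step ?j0 // mulr_sumr.
    rewrite le_eqVlt; apply/orP; left; apply/eqP/eq_bigr => x _.
    by rewrite ltnNge (leq_trans Nj) //= leq_addr.
  apply: (@le_trans _ _ (\sum_(x : cell) (s * c + delta + C * label_deviation (reveal st x)))).
    apply: ler_sum => x _; case: ltnP => // jN.
    (* The switch needs a cell with two new lines, so tree j starts with one row and one column. *)
    have [r0 c0 Nj1] : [/\ row_label st x.1 = 0%N, col_label st x.2 = 0%N & (ntrees st).+1 = j].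
      move: jN => /=; case: eqP => r0; case: eqP => c0 /=; split=> //; lia.
    have X0 : label_count (row_label st) j = 0%N.
      by apply: big1 => a _; have := wr a; case: eqP => //; lia.
    have Y0 : label_count (col_label st) j = 0%N.
      by apply: big1 => a _; have := wc a; case: eqP => //; lia.
    rewrite /tree_growth; have [-> ->] := reveal_countS st x j0.
    rewrite X0 Y0 r0 c0 Nj1 !eqxx [0%N == j]eq_sym [j == 0%N]eqn0Ngt j0 /=.
    have eN : ntrees (reveal st x) = j by rewrite /= r0 c0 addn1.
    rewrite /label_deviation eN.
    by apply: hgrow; apply: label_count_le.
  rewrite big_split /= sumr_const card_prod card_ord -mulr_sumr mulrDr.
  rewrite -[_ *+ (K * K)]mulr_natl natrM expr2 lerD2l mulrCA ler_wpM2l //.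
  by rewrite -expr2 label_deviation_step.
have zero_count (g : {ffun 'I_K -> nat}) : (forall a, g a != 0%N) -> label_count g 0 = 0%N.
  by move=> g0; apply: big1 => a _; rewrite (negPf (g0 a)).
have := average_explore phi_step.
rewrite {2}/phi /= j0 /label_deviation /=.
have -> : label_count ([ffun=> 0%N] : {ffun 'I_K -> nat}) 0 = K.
  rewrite -[RHS]card_ord -sum1_card; apply: eq_bigr => a _; by rewrite ffunE.
have -> : deviation 0 K%:R K%:R = 4 * K%:R.
  by rewrite /deviation /tree_excess -expr2 !subrr mul0r addr0 expr0n /= !add0r; ring.
apply: le_trans; rewrite mulr_sumr; apply: ler_sum => f; rewrite inE => /injectiveP f_inj.
have U0 := zero_count _ (row_label_final_neq0 f_inj).
have V0 := zero_count _ (col_label_final_neq0 f_inj).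
(* At the end every line is labelled, so [tree_growth] is the actual column count. If tree j never
   appeared, the count is 0, as the convention for a missing equilibrium demands, and [hend]
   applies. *)
rewrite /phi; case: ltnP => Nj; last by rewrite /tree_growth U0 V0 growth_end.
rewrite /label_deviation U0 V0.
have -> : label_count (col_label (final_label f)) j = 0%N.
  have [_ wc] := wf_explore f (K * K).
  by apply: big1 => a _; have := wc a; rewrite -/(final_label f); case: eqP => //; lia.
by rewrite mulr0 hend.
Qed.

End Deviation.

(** * From labels to the expected basin size *)

Lemma expected_BoA_label (R : realType) K j : (0 < K)%N -> (0 < j)%N ->
  expected_BoA_frac R K j =
  (\sum_(f in bijective_potentials K) (label_count (col_label (final_label f)) j)%:R)
   / #|bijective_potentials K|%:R.
Proof.
move=> K0 j0; rewrite /expected_BoA_frac; congr (_ / _).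
apply: eq_bigr => f; rewrite inE => /injectiveP f_inj.
by rewrite card_BoA // natrM mulrAC divff ?mul1r // pnatr_eq0 -lt0n.
Qed.

Lemma card_bijective_potentials K : #|bijective_potentials K| = (K * K)`!.
Proof. by rewrite card_inj_ffuns card_prod !card_ord ffactnn. Qed.

Lemma expected_BoA_le (R : realType) K j (s c delta C : R) : (0 < K)%N -> (0 < j)%N -> 0 <= C ->
  (forall U V, (U <= K)%N -> (V <= K)%N ->
     s * growth K U V 1 1 <= s * c + delta + C * deviation K j%:R U%:R V%:R) ->
  (forall N, (N < j)%N -> 0 <= s * c + delta + C * deviation K N%:R 0 0) ->
  s * expected_BoA_frac R K j <= s * c + delta + C * (4 * K%:R).
Proof.
move=> K0 j0 C0 h1 h2; rewrite expected_BoA_label // [leLHS]mulrA ler_pdivrMr.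
  by rewrite [leRHS]mulrC; apply: sum_final_label_le.
by rewrite ltr0n card_bijective_potentials fact_gt0.
Qed.

(** * Asymptotics *)

Section Asymptotics.
Variable R : realType.

(** Absorbs the factor k^2 of [growth_term_approx]: the termwise error becomes a multiple of 4^k /
    k!, and these sum to at most exp 4. *)
Lemma sqr_le_expn2 k : (k ^ 2 <= 2 * 2 ^ k)%N.
Proof.
case: k => [|[|[|k]]] //; elim: k => // k IH.
rewrite [(2 ^ k.+4)%N]expnS; apply: (@leq_trans (2 * k.+3 ^ 2)); last by rewrite leq_mul2l IH orbT.
by clear; rewrite !expnS !expn0; nia.
Qed.

Lemma exp_sum_le (x : R) n : 0 <= x -> \sum_(k < n) x ^+ k / k`!%:R <= expR x.
Proof.
move=> x0; rewrite -(big_mkord xpredT (fun k => x ^+ k / k`!%:R)).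
rewrite /expR; apply: (nondecreasing_cvgn_le (u_ := series (exp_coeff x))).
  by apply: nondecreasing_series => i _ _; rewrite /exp_coeff divr_ge0 ?exprn_ge0.
exact: is_cvg_series_exp_coeff.
Qed.

Lemma growth_approx K U V (w zeta : R) :
  (U <= K)%N -> (V <= K)%N -> 0 <= w <= 1 ->
  `|U%:R / K%:R - w| <= zeta -> `|V%:R / K%:R - w| <= zeta ->
  `|growth K U V 1 1 - \sum_(k < (2 * K).+1) w ^+ k / k`!%:R| <=
    2 * expR 4 * (zeta + 2 / K%:R).
Proof.
move=> UK VK w01 hU hV; rewrite /growth -sumrB.
apply: le_trans (ler_norm_sum _ _ _) _.
have z0 : 0 <= zeta + 2 / K%:R.
  by rewrite addr_ge0 ?divr_ge0 //; apply: le_trans hU; exact: normr_ge0.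
apply: (@le_trans _ _ (\sum_(k < (2 * K).+1) 2 * (zeta + 2 / K%:R) * (4 ^+ k / k`!%:R))).
  apply: ler_sum => k _; rewrite if_same mul1r.
  have kK : (k <= 2 * K)%N by rewrite -ltnS.
  apply: le_trans (growth_term_approx UK VK kK w01 hU hV) _.
  have -> : (4 : R) = 2 * 2 by ring.
  rewrite exprMn; have := sqr_le_expn2 k; rewrite -(ler_nat R) natrM !natrX => hk.
  rewrite mulrA mulrC [leRHS]mulrAC -mulrA [leRHS]mulrC -!mulrA ler_wpM2l //.
  have F0 : 0 <= (k`!%:R)^-1 :> R by rewrite invr_ge0.
  have p0 : 0 <= 2 ^+ k :> R by rewrite exprn_ge0.
  rewrite [leLHS]mulrCA [leRHS](_ : _ = (k`!%:R)^-1 * (2 ^+ k * (2 * 2 ^+ k))); last by ring.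
  by rewrite ler_wpM2l // ler_wpM2l.
rewrite -mulr_sumr mulrAC ler_wpM2r // ler_wpM2l //.
exact: exp_sum_le.
Qed.

(** Use u^2 - w^2 = u (u - v) + (u v - w^2) and u + w >= w. Closeness to w is thus reduced to U - V
    and UV, the quantities that concentrate. *)
Lemma dist_sqrt_le (u v w : R) : 0 <= u <= 1 -> 0 < w ->
  `|u - w| <= (`|u - v| + `|u * v - w ^+ 2|) / w.
Proof.
move=> /andP[u0 u1] w0; rewrite ler_pdivlMr //.
apply: (@le_trans _ _ `|(u - w) * (u + w)|).
  by rewrite normrM ler_wpM2l // ger0_norm ?addr_ge0 ?lerDr // ltW.
have -> : (u - w) * (u + w) = u * (u - v) + (u * v - w ^+ 2) by ring.
apply: le_trans (ler_normD _ _) _; rewrite lerD2r normrM ger0_norm //.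
exact: ler_piMl.
Qed.

(** Completing the square trades an absolute deviation for a squared one, which the supermartingale
    controls. *)
Lemma amgm_le (M a d : R) : 0 < d -> M * a <= d / 4 + M ^+ 2 / d * a ^+ 2.
Proof.
move=> d0; rewrite -subr_ge0.
have -> : d / 4 + M ^+ 2 / d * a ^+ 2 - M * a = (d / 2 - M * a) ^+ 2 / d.
  by field; rewrite gt_eqF.
by rewrite divr_ge0 ?sqr_ge0 // ltW.
Qed.

End Asymptotics.

(** * The limit at rank eps K *)

Section Limit.
Variables (R : realType) (eps : R).
Hypotheses (eps_gt0 : 0 < eps) (eps_lt : eps < 1 / 2).
Let w := Num.sqrt (1 - 2 * eps).
Let rank K := Num.truncn (eps * K%:R).

Let w_gt0 : 0 < w. Proof. by move: eps_lt => h; rewrite sqrtr_gt0; lra. Qed.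
Let w_sqr : w ^+ 2 = 1 - 2 * eps. Proof. by move: eps_lt => h; rewrite sqr_sqrtr //; lra. Qed.
Let w_le1 : w <= 1.
Proof. by move: eps_gt0 => h; rewrite -(ler_pXn2r (n := 2)) ?nnegrE ?ltW // w_sqr expr1n; lra. Qed.

Let rank_itv K : (rank K)%:R <= eps * K%:R < (rank K)%:R + 1.
Proof.
rewrite natr1; apply: truncn_itv.
by rewrite mulr_ge0 // ltW.
Qed.

Lemma dist_sqrt_le_deviation K U V : (0 < K)%N -> (U <= K)%N -> (V <= K)%N ->
  `|U%:R / K%:R - w| <= (`|U%:R - V%:R| / K%:R +
    2 * (`|tree_excess K (rank K)%:R U%:R V%:R| / K%:R) + 3 / K%:R) / w.
Proof.
set A := tree_excess _ _ _ _.
move=> K0 UK VK; have K1 : 1 <= K%:R :> R by rewrite ler1n.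
have KR : 0 < K%:R :> R by lra.
have u01 : 0 <= (U%:R / K%:R : R) <= 1.
  by apply/andP; split; [rewrite divr_ge0 | rewrite ler_pdivrMr // mul1r ler_nat].
apply: le_trans (dist_sqrt_le (V%:R / K%:R) u01 w_gt0) _.
rewrite ler_pM2r ?invr_gt0 // -addrA; apply: lerD.
  by rewrite -mulrBl normrM normfV (gtr0_norm KR).
have /andP[j1 j2] := rank_itv K.
set j := (rank K)%:R in A j1 j2 *.
(* Solve the definition of [tree_excess] for UV. The remainder, from rounding eps K down and from 2K
   - 1 in place of 2K, is at most 3 / K. *)
have -> : U%:R / K%:R * (V%:R / K%:R) - w ^+ 2 =
    (2 - K%:R^-1) * (A / K%:R) + (2 * (eps * K%:R - j) + j / K%:R) / K%:R.
  by rewrite w_sqr /A /tree_excess; field; rewrite gt_eqF /=; [rewrite gt_eqF|]; lra.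
have Ki : 0 < (K%:R^-1 : R) <= 1 by rewrite invr_gt0 KR invf_le1.
apply: le_trans (ler_normD _ _) _; apply: lerD.
  rewrite normrM ger0_norm; last by lra.
  by rewrite normrM normfV (gtr0_norm KR); apply: ler_wpM2r; [rewrite divr_ge0 | lra].
have j0 : 0 <= j / K%:R by rewrite divr_ge0 // ler0n.
have jK : j / K%:R <= 1 by move: eps_lt => h; rewrite ler_pdivrMr //; apply: le_trans j1 _; nra.
by rewrite normrM normfV (gtr0_norm KR) ger0_norm ?ler_pM2r ?invr_gt0 //; lra.
Qed.

Lemma growth_dist_le K U V : (0 < K)%N -> (U <= K)%N -> (V <= K)%N ->
  `|growth K U V 1 1 - \sum_(k < (2 * K).+1) w ^+ k / k`!%:R| <=
    2 * expR 4 / w * (`|U%:R - V%:R| / K%:R +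
      2 * (`|tree_excess K (rank K)%:R U%:R V%:R| / K%:R) + 5 / K%:R).
Proof.
set A := tree_excess _ _ _ _.
move=> K0 UK VK.
have KR : 0 < K%:R :> R by rewrite ltr0n.
have hU := dist_sqrt_le_deviation K0 UK VK.
have hV := dist_sqrt_le_deviation K0 VK UK.
have eA : tree_excess K (rank K)%:R V%:R U%:R = A.
  by rewrite /A /tree_excess [V%:R * _]mulrC.
rewrite eA [`|V%:R - U%:R|]distrC in hV; rewrite -/A in hU.
have w01 : 0 <= w <= 1 by rewrite w_le1 ltW.
apply: le_trans (growth_approx UK VK w01 hU hV) _.
rewrite -[leRHS]mulrA ler_wpM2l ?mulr_ge0 ?expR_ge0 // -/A.
set s := _ + 2 * _.
(* The 5 is 3 from [dist_sqrt_le_deviation] plus 2 from [growth_approx], the latter enlarged by 1 /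
   w >= 1. *)
have -> : w^-1 * (s + 5 / K%:R) = (s + 3 / K%:R) / w + 2 / K%:R / w by field; rewrite !gt_eqF.
by rewrite lerD2l; apply: ler_peMr; [rewrite divr_ge0 | rewrite invf_ge1].
Qed.

(** The error d consists of four quarters: the tail of the exponential series, the 5 / K term and
    two uses of [amgm_le]. The rest is C / K^2 times the initial deviation 4K. *)
Lemma expected_BoA_close (d : R) : 0 < d ->
  exists2 C : R, 0 <= C & \forall K \near \oo,
    `|expected_BoA_frac R K (rank K) - expR w| <= d + C * (4 / K%:R).
Proof.
move=> d0; pose M := 2 * expR 4 / w; pose c := expR w.
have M0 : 0 < M by rewrite divr_gt0 // mulr_gt0 ?expR_gt0.
have h := eps_lt; have h0 := eps_gt0.
have e0 : 0 < 1 / 2 - eps by lra.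
(* The first summand pays for the two uses of [amgm_le], the second for explorations that end before
   the required tree appears. *)
pose C := 4 * M ^+ 2 / d + c / (1 / 2 - eps) ^+ 2.
have c0 : 0 < c := expR_gt0 _.
have C1 : 0 <= 4 * M ^+ 2 / d := divr_ge0 (mulr_ge0 (ler0n _ 4) (sqr_ge0 M)) (ltW d0).
have C2 : 0 <= c / (1 / 2 - eps) ^+ 2 := divr_ge0 (ltW c0) (sqr_ge0 _).
have C0 : 0 <= C by rewrite addr_ge0.
have hC1 : 4 * M ^+ 2 / d <= C by rewrite lerDl.
have hC2 : c / (1 / 2 - eps) ^+ 2 <= C by rewrite lerDr.
have growthM K U V := @growth_dist_le K U V.
rewrite -/M in growthM.
clearbody C; exists C => //.
have exp_cvg : (fun K => \sum_(k < (2 * K).+1) w ^+ k / k`!%:R : R) @ \oo --> c.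
  have cv : (fun n => \sum_(k < n) w ^+ k / k`!%:R : R) @ \oo --> expR w.
    rewrite (_ : (fun n => _) = series (exp_coeff w)); first exact: is_cvg_series_exp_coeff.
    by apply/funext => n; rewrite /series /= big_mkord.
  move=> P /cv[N _ NP]; exists N => // K /= NK.
  by apply: (NP (2 * K).+1); rewrite /= (leq_trans NK) // mul2n -addnn -addnS leq_addr.
have tailN : \forall K \near \oo, `|c - \sum_(k < (2 * K).+1) w ^+ k / k`!%:R| <= d / 4.
  by move/cvgrPdist_le: exp_cvg; apply; rewrite divr_gt0.
rewrite -/c; clearbody c M; near=> K.
have K0 : (0 < K)%N by near: K; exists 1%N.
have KR : 0 < K%:R :> R by rewrite ltr0n.
have jpos : (0 < rank K)%N.
  have : (1 / eps) <= K%:R by near: K; apply: nbhs_infty_ger.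
  rewrite ler_pdivrMr // -(ltr_nat R) => hK.
  by have /andP[_] := rank_itv K; rewrite mulrC; lra.
have Mk : M * (5 / K%:R) <= d / 4.
  have : 20 * M / d <= K%:R by near: K; apply: nbhs_infty_ger.
  by rewrite ler_pdivrMr // mulrA ler_pdivrMr // => hK; nra.
have tail : `|\sum_(k < (2 * K).+1) w ^+ k / k`!%:R - c| <= d / 4.
  by rewrite distrC; near: K.
have dev_ge (N U V : R) : 0 <= U -> 0 <= V ->
    (U - V) ^+ 2 + tree_excess K N U V ^+ 2 <= deviation K N U V.
  by move=> U0 V0; rewrite /deviation lerDl mulr_ge0 // addr_ge0.
have grow U V : (U <= K)%N -> (V <= K)%N -> `|growth K U V 1 1 - c| <=
    d + C / K%:R ^+ 2 * deviation K (rank K)%:R U%:R V%:R.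
  move=> UK VK; have := growthM _ _ _ K0 UK VK.
  have := dev_ge (rank K)%:R U%:R V%:R (ler0n _ _) (ler0n _ _).
  move: (tree_excess _ _ _ _) (deviation _ _ _ _) (\sum_(k < _) _) tail => A D S tail hD hS.
  have -> : growth K U V 1 1 - c = (growth K U V 1 1 - S) + (S - c) by ring.
  apply: le_trans (ler_normD _ _) _; apply: le_trans (lerD hS tail) _.
  have h1 := amgm_le M (`|U%:R - V%:R| / K%:R) d0.
  have h2 := amgm_le (2 * M) (`|A| / K%:R) d0.
  have h3 : (4 * M ^+ 2 / d) * ((U%:R - V%:R) ^+ 2 + A ^+ 2) / K%:R ^+ 2 <= C / K%:R ^+ 2 * D.
    rewrite [leLHS]mulrAC; apply: ler_pM => //; last first.
    + by rewrite ler_pM2r ?invr_gt0 ?exprn_gt0.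
    + exact: addr_ge0 (sqr_ge0 _) (sqr_ge0 _).
    + exact: divr_ge0 C1 (sqr_ge0 _).
  have h4 : M ^+ 2 / d * (`|U%:R - V%:R| / K%:R) ^+ 2 +
      (2 * M) ^+ 2 / d * (`|A| / K%:R) ^+ 2 <=
      (4 * M ^+ 2 / d) * ((U%:R - V%:R) ^+ 2 + A ^+ 2) / K%:R ^+ 2.
    have q x : (`|x| / K%:R) ^+ 2 = x ^+ 2 / K%:R ^+ 2 :> R.
      by rewrite expr_div_n real_normK ?num_real.
    rewrite !q -subr_ge0.
    have -> : 4 * M ^+ 2 / d * ((U%:R - V%:R) ^+ 2 + A ^+ 2) / K%:R ^+ 2 -
      (M ^+ 2 / d * ((U%:R - V%:R) ^+ 2 / K%:R ^+ 2) + (2 * M) ^+ 2 / d * (A ^+ 2 / K%:R ^+ 2)) =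
      3 * (M * (U%:R - V%:R) / K%:R) ^+ 2 / d by field; rewrite !gt_eqF.
    exact: divr_ge0 (mulr_ge0 (ler0n _ 3) (sqr_ge0 _)) (ltW d0).
  rewrite !mulrDr; lra.
(* If the exploration ends with too few trees, [tree_excess] is N - K^2 / (2K - 1), which is at most
   -(1/2 - eps) K; the deviation is then of order K^2 and outweighs exp w. *)
have small N : (N < rank K)%N -> c <= C / K%:R ^+ 2 * deviation K N%:R 0 0.
  move=> Nj; have /andP[j1 j2] := rank_itv K.
  have := dev_ge N%:R 0 0 (lexx _) (lexx _); rewrite subrr expr0n /= add0r.
  set A := tree_excess _ _ _ _; set D := deviation _ _ _ _ => hD.
  have NjR : N%:R + 1 <= (rank K)%:R :> R by rewrite natr1 ler_nat.
  have K1 : 1 <= K%:R :> R by rewrite ler1n.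
  have hA : A <= - ((1 / 2 - eps) * K%:R).
    have : K%:R / 2 <= K%:R ^+ 2 / (2 * K%:R - 1) :> R.
      by rewrite ler_pdivlMr; nra.
    by rewrite /A /tree_excess mul0r sub0r mulNr; lra.
  have hA2 : ((1 / 2 - eps) * K%:R) ^+ 2 <= A ^+ 2.
    have : 0 <= (1 / 2 - eps) * K%:R by rewrite mulr_ge0 // ltW.
    by move: hA; move: ((1 / 2 - eps) * K%:R) => z hA z0; nra.
  apply: (@le_trans _ _ (c / (1 / 2 - eps) ^+ 2 / K%:R ^+ 2 * ((1 / 2 - eps) * K%:R) ^+ 2)).
    rewrite le_eqVlt; apply/orP; left; apply/eqP; field.
    by rewrite !gt_eqF //; lra.
  apply: ler_pM; rewrite ?sqr_ge0 //.
    + exact: divr_ge0 C2 (sqr_ge0 _).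
    + by rewrite ler_pM2r ?invr_gt0 ?exprn_gt0.
    + exact: le_trans hA2 hD.
have CK0 : 0 <= C / K%:R ^+ 2 by exact: divr_ge0 C0 (sqr_ge0 _).
have bound (s : R) : s = 1 \/ s = -1 -> s * expected_BoA_frac R K (rank K) <=
    s * c + d + C / K%:R ^+ 2 * (4 * K%:R).
  move=> hs; apply: expected_BoA_le => // [U V UK VK|N Nj].
    have := grow U V UK VK; rewrite ler_norml => /andP[g1 g2].
    by case: hs => ->; lra.
  have := small N Nj.
  by case: hs => ->; lra.
have -> : C * (4 / K%:R) = C / K%:R ^+ 2 * (4 * K%:R) by field; rewrite gt_eqF.
have b1 := bound 1 (or_introl erefl).
have b2 := bound (-1) (or_intror erefl).
by rewrite ler_norml; apply/andP; split; lra.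
Unshelve. all: by end_near.
Qed.

End Limit.

Theorem theorem4p4 (R : realType) (eps : R) (heps0 : 0 < eps) (heps1 : eps < 1 / 2) :
  ((fun K : nat => expected_BoA_frac R K (Num.truncn (eps * K%:R))) : R^nat)
    @ \oo --> (expR (Num.sqrt (1 - 2 * eps)) : R).
Proof.
apply/cvgrPdist_le => e e0.
have e20 : 0 < e / 2 by rewrite divr_gt0.
have [C C0 close] := expected_BoA_close heps0 heps1 e20.
near=> K; rewrite distrC.
have KR : 0 < K%:R :> R by rewrite ltr0n; near: K; exists 1%N.
apply: (@le_trans _ _ (e / 2 + C * (4 / K%:R))); first by near: K.
rewrite mulrA -lerBrDl ler_pdivrMr //.
have : 8 * C / e <= K%:R by near: K; apply: nbhs_infty_ger.
by rewrite ler_pdivrMr // => hK; nra.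
Unshelve. all: by end_near.
Qed.
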